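(* Let $\mathcal C$ be an ideal determined category and let $\mathcal X$ be a Birkhoff subcategory of $\mathcal C$, with inclusion $U\colon\mathcal X\to\mathcal C$ and reflector (left adjoint) $F\colon\mathcal C\to\mathcal X$. Then the corresponding pointed endofunctor $L=UF\colon\mathcal C\to\mathcal C$ is conditionally flat.
   Context: A category is regular if it is finitely complete, every morphism factors as a regular epimorphism followed by a monomorphism, and regular epimorphisms are stable under pullback. An ideal determined category is a pointed regular category $\mathcal C$ with binary coproducts such that: (1) every regular epimorphism in $\mathcal C$ is normal, i.e. a cokernel; (2) normal monomorphisms are stable under images: for every commutative square $f'\circ a=b\circ f$ with $a\colon A\to A'$ a normal monomorphism (i.e. a kernel), $f\colon A\to B$ and $f'\colon A'\to B'$ normal epimorphisms, and $b\colon B\to B'$ a monomorphism, the morphism $b$ is also a normal monomorphism. A Birkhoff subcategory $\mathcal X$ of $\mathcal C$ is a full replete reflective subcategory such that each component $\eta_A\colon A\to UF(A)$ of the unit is a regular epimorphism, and which is closed under regular quotients: if $A\to B$ is a regular epimorphism in $\mathcal C$ with $A$ in $\mathcal X$, then $B$ is in $\mathcal X$. An extension in $\mathcal C$ is a short exact sequence $0\to K\to E\to Q\to 0$ (the first map is a kernel of the second, the second is a cokernel of the first). An extension is $L$-flat if $0\to L(K)\to L(E)\to L(Q)\to 0$ is again an extension. The functor $L$ is conditionally flat if every pullback of an $L$-flat extension is $L$-flat: for every $L$-flat extension $0\to K\to E\to Q\to 0$ and every morphism $A\to Q$, the induced extension $0\to K\to E\times_Q A\to A\to 0$ is $L$-flat.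 *)

(* Defs.v *)
(* Stdlib; hom-types are compared by Leibniz equality. *)
From Stdlib Require Import List.

Set Implicit Arguments.
Unset Strict Implicit.

Declare Scope cat_scope.
Delimit Scope cat_scope with cat.
Local Open Scope cat_scope.

Record Category := {
  Ob :> Type;
  Hom : Ob -> Ob -> Type;
  idm : forall A : Ob, Hom A A;
  comp : forall A B D : Ob, Hom B D -> Hom A B -> Hom A D;
  comp_assoc : forall (A B D E : Ob) (h : Hom D E) (g : Hom B D) (f : Hom A B),
    comp h (comp g f) = comp (comp h g) f;
  comp_idl : forall (A B : Ob) (f : Hom A B), comp (idm B) f = f;
  comp_idr : forall (A B : Ob) (f : Hom A B), comp f (idm A) = f
}.

Arguments Hom {c} A B.
Arguments idm {c} A.
Arguments comp {c A B D} g f.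

Notation "g ∘ f" := (comp g f) (at level 40, left associativity) : cat_scope.

Record Functor (C D : Category) := {
  fobj :> C -> D;
  fmap : forall A B : C, Hom A B -> Hom (fobj A) (fobj B);
  fmap_id : forall A : C, fmap (idm A) = idm (fobj A);
  fmap_comp : forall (A B E : C) (g : Hom B E) (f : Hom A B),
    fmap (g ∘ f) = fmap g ∘ fmap f
}.

Arguments fmap {C D} F {A B} f : rename.

Definition id_functor (C : Category) : Functor C C :=
  {| fobj := fun A => A;
     fmap := fun A B f => f;
     fmap_id := fun A => eq_refl;
     fmap_comp := fun A B E g f => eq_refl |}.

Definition comp_functor (C D E : Category) (G : Functor D E) (F : Functor C D) :
  Functor C E :=
  {| fobj := fun A => G (F A);
     fmap := fun A B f => fmap G (fmap F f);
     fmap_id := fun A => eq_trans (f_equal (fmap G) (fmap_id F A)) (fmap_id G (F A));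
     fmap_comp := fun A B X g f =>
       eq_trans (f_equal (fmap G) (fmap_comp F g f))
                (fmap_comp G (fmap F g) (fmap F f)) |}.

Record NatTrans (C D : Category) (G H : Functor C D) := {
  component :> forall A : C, Hom (G A) (H A);
  naturality : forall (A B : C) (f : Hom A B),
    component B ∘ fmap G f = fmap H f ∘ component A
}.

(* [F] is left adjoint to [U]. *)
Record Adjunction (C D : Category) (F : Functor C D) (U : Functor D C) := {
  unit : NatTrans (id_functor C) (comp_functor U F);
  counit : NatTrans (comp_functor F U) (id_functor D);
  triangle_left : forall A : C, counit (F A) ∘ fmap F (unit A) = idm (F A);
  triangle_right : forall X : D, fmap U (counit X) ∘ unit (U X) = idm (U X)
}.

Definition finite_type (T : Type) : Prop := exists l : list T, forall x, In x l.

Definition finite_category (J : Category) : Prop :=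
  finite_type J /\ forall i j : J, finite_type (Hom i j).

Definition is_cone (J C : Category) (D : Functor J C) (X : C)
  (c : forall j : J, Hom X (D j)) : Prop :=
  forall (i j : J) (u : Hom i j), fmap D u ∘ c i = c j.

Definition is_limit (J C : Category) (D : Functor J C) (X : C)
  (c : forall j : J, Hom X (D j)) : Prop :=
  is_cone c /\
  forall (Y : C) (d : forall j : J, Hom Y (D j)), is_cone d ->
    exists! t : Hom Y X, forall j, c j ∘ t = d j.

Definition finitely_complete (C : Category) : Prop :=
  forall (J : Category) (D : Functor J C), finite_category J ->
    exists (X : C) (c : forall j : J, Hom X (D j)), is_limit c.

(* The square  f ∘ p1 = g ∘ p2  is a pullback of [f] and [g]. *)
Definition is_pullback (C : Category) (A B D P : C)
  (f : Hom A D) (g : Hom B D) (p1 : Hom P A) (p2 : Hom P B) : Prop :=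
  f ∘ p1 = g ∘ p2 /\
  forall (Y : C) (h1 : Hom Y A) (h2 : Hom Y B), f ∘ h1 = g ∘ h2 ->
    exists! t : Hom Y P, p1 ∘ t = h1 /\ p2 ∘ t = h2.

Definition is_coequalizer (C : Category) (R A B : C)
  (r1 r2 : Hom R A) (q : Hom A B) : Prop :=
  q ∘ r1 = q ∘ r2 /\
  forall (Y : C) (h : Hom A Y), h ∘ r1 = h ∘ r2 ->
    exists! t : Hom B Y, t ∘ q = h.

Definition is_coproduct (C : Category) (A B S : C)
  (i1 : Hom A S) (i2 : Hom B S) : Prop :=
  forall (Y : C) (h1 : Hom A Y) (h2 : Hom B Y),
    exists! t : Hom S Y, t ∘ i1 = h1 /\ t ∘ i2 = h2.

Definition has_binary_coproducts (C : Category) : Prop :=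
  forall A B : C, exists (S : C) (i1 : Hom A S) (i2 : Hom B S), is_coproduct i1 i2.

Definition is_iso (C : Category) (A B : C) (f : Hom A B) : Prop :=
  exists g : Hom B A, g ∘ f = idm A /\ f ∘ g = idm B.

Definition is_mono (C : Category) (A B : C) (f : Hom A B) : Prop :=
  forall (Y : C) (u v : Hom Y A), f ∘ u = f ∘ v -> u = v.

Definition is_regular_epi (C : Category) (A B : C) (f : Hom A B) : Prop :=
  exists (R : C) (r1 r2 : Hom R A), is_coequalizer r1 r2 f.

Definition regular_category (C : Category) : Prop :=
  finitely_complete C /\
  (forall (A B : C) (f : Hom A B),
     exists (I : C) (e : Hom A I) (m : Hom I B),
       is_regular_epi e /\ is_mono m /\ f = m ∘ e) /\
  (forall (A B D P : C) (f : Hom A D) (g : Hom B D) (p1 : Hom P A) (p2 : Hom P B),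
     is_pullback f g p1 p2 -> is_regular_epi f -> is_regular_epi p2).

Definition is_zero_object (C : Category) (Z : C) : Prop :=
  (forall A : C, exists! f : Hom Z A, True) /\
  (forall A : C, exists! f : Hom A Z, True).

Definition pointed (C : Category) : Prop := exists Z : C, is_zero_object Z.

Definition is_zero (C : Category) (A B : C) (f : Hom A B) : Prop :=
  exists (Z : C) (u : Hom A Z) (v : Hom Z B), is_zero_object Z /\ f = v ∘ u.

Definition is_kernel (C : Category) (K A B : C) (k : Hom K A) (f : Hom A B) : Prop :=
  is_zero (f ∘ k) /\
  forall (Y : C) (h : Hom Y A), is_zero (f ∘ h) -> exists! t : Hom Y K, k ∘ t = h.

Definition is_cokernel (C : Category) (A B Q : C) (q : Hom B Q) (f : Hom A B) : Prop :=
  is_zero (q ∘ f) /\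
  forall (Y : C) (h : Hom B Y), is_zero (h ∘ f) -> exists! t : Hom Q Y, t ∘ q = h.

Definition is_normal_mono (C : Category) (K A : C) (k : Hom K A) : Prop :=
  exists (B : C) (f : Hom A B), is_kernel k f.

Definition is_normal_epi (C : Category) (B Q : C) (q : Hom B Q) : Prop :=
  exists (A : C) (f : Hom A B), is_cokernel q f.

Definition ideal_determined (C : Category) : Prop :=
  pointed C /\
  regular_category C /\
  has_binary_coproducts C /\
  (forall (A B : C) (f : Hom A B), is_regular_epi f -> is_normal_epi f) /\
  (forall (A A' B B' : C)
          (a : Hom A A') (f : Hom A B) (f' : Hom A' B') (b : Hom B B'),
     f' ∘ a = b ∘ f ->
     is_normal_mono a -> is_normal_epi f -> is_normal_epi f' -> is_mono b ->
     is_normal_mono b).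

Definition full_subcategory (C : Category) (X : C -> Prop) : Category :=
  {| Ob := {A : C | X A};
     Hom := fun A B => Hom (proj1_sig A) (proj1_sig B);
     idm := fun A => idm (proj1_sig A);
     comp := fun A B D g f => g ∘ f;
     comp_assoc := fun A B D E h g f => comp_assoc h g f;
     comp_idl := fun A B f => comp_idl f;
     comp_idr := fun A B f => comp_idr f |}.

Definition inclusion (C : Category) (X : C -> Prop) :
  Functor (full_subcategory X) C :=
  {| fobj := fun A : full_subcategory X => proj1_sig A;
     fmap := fun A B f => f;
     fmap_id := fun A => eq_refl;
     fmap_comp := fun A B E g f => eq_refl |}.

(* Fullness is built into [full_subcategory] and reflectivity is the
   adjunction [adj]. *)
Definition birkhoff (C : Category) (X : C -> Prop)
  (F : Functor C (full_subcategory X)) (adj : Adjunction F (inclusion X)) : Prop :=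
  (forall (A B : C) (f : Hom A B), is_iso f -> X A -> X B) /\
  (forall A : C, is_regular_epi (unit adj A)) /\
  (forall (A B : C) (f : Hom A B), is_regular_epi f -> X A -> X B).

Definition is_extension (C : Category) (K E Q : C) (k : Hom K E) (p : Hom E Q) : Prop :=
  is_kernel k p /\ is_cokernel p k.

Definition is_flat (C : Category) (L : Functor C C) (K E Q : C)
  (k : Hom K E) (p : Hom E Q) : Prop :=
  is_extension k p /\ is_extension (fmap L k) (fmap L p).

(* The map [k'] induced by [k] on the pullback [P] of [p] and [g] is the one
   determined by  p1 ∘ k' = k  and  p2 ∘ k' = 0. *)
Definition conditionally_flat (C : Category) (L : Functor C C) : Prop :=
  forall (K E Q : C) (k : Hom K E) (p : Hom E Q), is_flat L k p ->
  forall (A P : C) (g : Hom A Q) (p1 : Hom P E) (p2 : Hom P A),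
    is_pullback p g p1 p2 ->
  forall k' : Hom K P, p1 ∘ k' = k -> is_zero (p2 ∘ k') ->
    is_flat L k' p2.

(* Main.v *)
(* For an extension pulled back along [g : A -> Q], the map [L k'] is a
   monomorphism because [L p1 ∘ L k' = L k] is a kernel.  The naturality square
   of the unit at [k'] then exhibits [L k'] as the image of the normal
   monomorphism [k'], so [L k'] is normal by ideal determinacy.  Closure of [X]
   under regular quotients makes [L p2] a cokernel of [L k'] in the whole
   category, and a normal monomorphism is the kernel of its cokernel. *)
Require Import Defs.

Set Implicit Arguments.
Unset Strict Implicit.

Local Open Scope cat_scope.

Definition is_epi (C : Category) (A B : C) (f : Hom A B) : Prop :=
  forall (Y : C) (u v : Hom B Y), u ∘ f = v ∘ f -> u = v.

(** * Zero morphisms, kernels and cokernels *)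

Section ZeroMorphisms.

Variable C : Category.

Lemma is_zero_compl (A B D : C) (g : Hom B D) (f : Hom A B) :
  is_zero f -> is_zero (g ∘ f).
Proof.
  intros (Z & u & v & hZ & ->). exists Z, u, (g ∘ v).
  split; [exact hZ | apply comp_assoc].
Qed.

Lemma is_zero_compr (A B D : C) (g : Hom B D) (f : Hom A B) :
  is_zero g -> is_zero (g ∘ f).
Proof.
  intros (Z & u & v & hZ & ->). exists Z, (u ∘ f), v.
  split; [exact hZ | symmetry; apply comp_assoc].
Qed.

Lemma zero_object_init (Z A : C) (u v : Hom Z A) : is_zero_object Z -> u = v.
Proof.
  intros [hi _]. destruct (hi A) as (w & _ & hw).
  now rewrite <- (hw u I), <- (hw v I).
Qed.

Lemma zero_object_term (Z A : C) (u v : Hom A Z) : is_zero_object Z -> u = v.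
Proof.
  intros [_ ht]. destruct (ht A) as (w & _ & hw).
  now rewrite <- (hw u I), <- (hw v I).
Qed.

(** The two maps may factor through different zero objects; the map [w] between these identifies the
    factorizations. *)
Lemma is_zero_unique (A B : C) (f g : Hom A B) : is_zero f -> is_zero g -> f = g.
Proof.
  intros (Z & u & v & hZ & ->) (Z' & u' & v' & hZ' & ->).
  destruct (proj1 hZ Z') as (w & _ & _).
  rewrite (zero_object_term u' (w ∘ u) hZ'), comp_assoc.
  now rewrite (zero_object_init (v' ∘ w) v hZ).
Qed.

Lemma is_zero_exists (A B : C) : pointed C -> exists z : Hom A B, is_zero z.
Proof.
  intros [Z hZ].
  destruct (proj1 hZ B) as (v & _ & _), (proj2 hZ A) as (u & _ & _).
  exists (v ∘ u), Z, u, v. now split.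
Qed.

Lemma is_zero_mono (A B D : C) (m : Hom B D) (f : Hom A B) :
  is_mono m -> is_zero (m ∘ f) -> is_zero f.
Proof.
  intros hm hz.
  assert (hp : pointed C) by (destruct hz as (Z & _ & _ & hZ & _); now exists Z).
  destruct (is_zero_exists A B hp) as (z & hzz).
  replace f with z; [exact hzz |].
  apply hm, is_zero_unique; [now apply is_zero_compl | exact hz].
Qed.

Lemma kernel_mono (K A B : C) (k : Hom K A) (f : Hom A B) :
  is_kernel k f -> is_mono k.
Proof.
  intros [hz hu] Y u v huv.
  destruct (hu Y (k ∘ v)) as (t & _ & ht).
  - rewrite comp_assoc. now apply is_zero_compr.
  - now rewrite <- (ht u huv), <- (ht v eq_refl).
Qed.

Lemma cokernel_epi (A B Q : C) (q : Hom B Q) (f : Hom A B) :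
  is_cokernel q f -> is_epi q.
Proof.
  intros [hz hu] Y u v huv.
  destruct (hu Y (v ∘ q)) as (t & _ & ht).
  - rewrite <- comp_assoc. now apply is_zero_compl.
  - now rewrite <- (ht u huv), <- (ht v eq_refl).
Qed.

Lemma cokernel_regular_epi (A B Q : C) (q : Hom B Q) (f : Hom A B) :
  pointed C -> is_cokernel q f -> is_regular_epi q.
Proof.
  intros hp [hz hu]. destruct (is_zero_exists A B hp) as (z & hzz).
  exists A, f, z. split.
  - apply is_zero_unique; [exact hz | now apply is_zero_compl].
  - intros Y h e. apply hu. rewrite e. now apply is_zero_compl.
Qed.

Lemma regular_epi_epi (A B : C) (f : Hom A B) : is_regular_epi f -> is_epi f.
Proof.
  intros (R & r1 & r2 & he & hu) Y u v huv.
  destruct (hu Y (v ∘ f)) as (t & _ & ht).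
  - now rewrite <- !comp_assoc, he.
  - now rewrite <- (ht u huv), <- (ht v eq_refl).
Qed.

(** The map [f] whose cokernel is [q] factors through [k], so whatever kills [k] also kills [f]. *)
Lemma normal_epi_cokernel_of_kernel (K B Q : C) (q : Hom B Q) (k : Hom K B) :
  is_normal_epi q -> is_kernel k q -> is_cokernel q k.
Proof.
  intros (A & f & hz & hu) [hkz hku]. split; [exact hkz |].
  intros Y h hh. apply hu.
  destruct (hku A f hz) as (s & <- & _).
  rewrite comp_assoc. now apply is_zero_compr.
Qed.

Lemma pullback_kernel (K E Q A P : C) (k : Hom K E) (p : Hom E Q) (g : Hom A Q)
  (p1 : Hom P E) (p2 : Hom P A) (k' : Hom K P) :
  is_kernel k p -> is_pullback p g p1 p2 ->
  p1 ∘ k' = k -> is_zero (p2 ∘ k') -> is_kernel k' p2.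
Proof.
  intros hk [hsq hpb] hk1 hk2. split; [exact hk2 |].
  intros Y h hh.
  destruct (proj2 hk Y (p1 ∘ h)) as (t & ht & _).
  { rewrite comp_assoc, hsq, <- comp_assoc. now apply is_zero_compl. }
  exists t. split.
  (* The pullback projections are jointly monic, and [k' ∘ t] and [h] agree after each of them: both
     give [k ∘ t] along [p1] and zero along [p2]. *)
  - destruct (hpb Y (p1 ∘ h) (p2 ∘ h)) as (w & _ & hw).
    { now rewrite !comp_assoc, hsq. }
    rewrite <- (hw h (conj eq_refl eq_refl)). symmetry. apply hw. split.
    + now rewrite comp_assoc, hk1.
    + apply is_zero_unique; [| exact hh].
      rewrite comp_assoc. now apply is_zero_compr.
  - intros t' ht'. apply (kernel_mono hk).
    now rewrite ht, <- ht', comp_assoc, hk1.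
Qed.

(** Pullback stability makes [p2] a regular epimorphism, hence a normal one, hence the cokernel of
    its kernel [k']. *)
Lemma extension_pullback (K E Q A P : C) (k : Hom K E) (p : Hom E Q) (g : Hom A Q)
  (p1 : Hom P E) (p2 : Hom P A) (k' : Hom K P) :
  ideal_determined C -> is_extension k p -> is_pullback p g p1 p2 ->
  p1 ∘ k' = k -> is_zero (p2 ∘ k') -> is_extension k' p2.
Proof.
  intros (hp & (_ & _ & hst) & _ & hn & _) [hk hc] hpb hk1 hk2.
  assert (hk' : is_kernel k' p2) by exact (pullback_kernel hk hpb hk1 hk2).
  split; [exact hk' |].
  apply normal_epi_cokernel_of_kernel; [| exact hk'].
  apply hn, (hst _ _ _ _ _ _ _ _ hpb), (cokernel_regular_epi hp hc).
Qed.

(** Dually to the case of normal epimorphisms, the map [f] whose kernel is [k] factors through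
    [q]. *)
Lemma normal_mono_kernel_of_cokernel (K A Q : C) (k : Hom K A) (q : Hom A Q) :
  is_normal_mono k -> is_cokernel q k -> is_kernel k q.
Proof.
  intros (B & f & hz & hu) [hqz hqu]. split; [exact hqz |].
  intros Y h hh. apply hu.
  destruct (hqu B f hz) as (s & <- & _).
  rewrite <- comp_assoc. now apply is_zero_compl.
Qed.

End ZeroMorphisms.

(** * Reflectors whose unit is a regular epimorphism *)

Section Reflection.

Variables (C : Category) (X : C -> Prop) (F : Functor C (full_subcategory X)).
Variable adj : Adjunction F (inclusion X).

Let L : Functor C C := comp_functor (inclusion X) F.
Let eta (A : C) : Hom A (L A) := unit adj A.

Lemma unit_natural (A B : C) (f : Hom A B) : fmap L f ∘ eta A = eta B ∘ f.
Proof. symmetry. exact (naturality (unit adj) f). Qed.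

Lemma unit_factor (A B : C) (f : Hom A B) :
  X B -> exists t : Hom (L A) B, t ∘ eta A = f.
Proof.
  intros hB. pose (B' := exist X B hB : full_subcategory X).
  (* This is the adjoint transpose of [f]; naturality of the unit reduces the claim to a triangle
     identity. *)
  exists ((counit adj B' : Hom (L B) B) ∘ fmap L f).
  rewrite <- comp_assoc, unit_natural, comp_assoc.
  rewrite <- (comp_idl f) at 2. apply (f_equal (fun u => u ∘ f)).
  exact (triangle_right adj B').
Qed.

Hypothesis unit_regular_epi : forall A : C, is_regular_epi (eta A).

(** By naturality, precomposing with [eta A] turns [fmap L f] into [eta B ∘ f], a composite of
    epimorphisms. *)
Lemma reflector_epi (A B : C) (f : Hom A B) : is_epi f -> is_epi (fmap L f).
Proof.
  intros hf Y u v huv.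
  apply (regular_epi_epi (unit_regular_epi B)), hf.
  now rewrite <- !comp_assoc, <- unit_natural, !comp_assoc, huv.
Qed.

Lemma reflector_zero_object (Z : C) : is_zero_object Z -> is_zero_object (L Z).
Proof.
  intros hZ. destruct (proj2 hZ (L Z)) as (z & _ & _).
  (* The unit at [Z] is an isomorphism: after cancelling the epimorphism [eta Z], both sides become
     maps out of a zero object. *)
  assert (hz : eta Z ∘ z = idm (L Z)).
  { apply (regular_epi_epi (unit_regular_epi Z)). now apply zero_object_init. }
  split; intros A.
  - destruct (proj1 hZ A) as (u & _ & _). exists (u ∘ z). split; [exact I |].
    intros v _. rewrite (zero_object_init u (v ∘ eta Z) hZ).
    now rewrite <- comp_assoc, hz, comp_idr.
  - destruct (proj2 hZ A) as (u & _ & _). exists (eta Z ∘ u). split; [exact I |].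
    intros v _. rewrite (zero_object_term u (z ∘ v) hZ).
    now rewrite comp_assoc, hz, comp_idl.
Qed.

Lemma reflector_zero (A B : C) (f : Hom A B) : is_zero f -> is_zero (fmap L f).
Proof.
  intros (Z & u & v & hZ & ->). exists (L Z), (fmap L u), (fmap L v).
  split; [now apply reflector_zero_object | apply fmap_comp].
Qed.

End Reflection.

(** * Cokernels and normal monomorphisms under a Birkhoff reflector *)

Section Birkhoff.

Variables (C : Category) (hC : ideal_determined C).
Variables (X : C -> Prop) (F : Functor C (full_subcategory X)).
Variables (adj : Adjunction F (inclusion X)) (hX : birkhoff adj).

Let L : Functor C C := comp_functor (inclusion X) F.
Let eta (A : C) : Hom A (L A) := unit adj A.

Let eta_natural (A B : C) (f : Hom A B) : fmap L f ∘ eta A = eta B ∘ f.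
Proof. exact (unit_natural adj f). Qed.

Lemma birkhoff_cokernel (K E Q : C) (k : Hom K E) (p : Hom E Q) :
  is_cokernel p k -> is_cokernel (fmap L p) (fmap L k).
Proof.
  intros hc. destruct hX as (_ & heta & hquot).
  destruct hC as (_ & (_ & hfact & _) & _).
  split.
  { rewrite <- fmap_comp. apply (reflector_zero heta), hc. }
  intros Y h hh.
  (* The image of [h] is a regular quotient of [L E], so it lies in [X] and
     receives an extension along the unit of [Q]. *)
  destruct (hfact _ _ h) as (I & e & m & he & hm & ->).
  assert (hI : X I) by exact (hquot _ _ e he (proj2_sig (F E))).
  assert (hez : is_zero (e ∘ fmap L k)).
  { apply (is_zero_mono hm). now rewrite comp_assoc. }
  (* By naturality [e ∘ eta E ∘ k] equals [e ∘ fmap L k ∘ eta K], which is zero, so [e ∘ eta E]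
     descends along [p]. *)
  destruct (proj2 hc I (e ∘ eta E)) as (t & ht & _).
  { rewrite <- comp_assoc, <- eta_natural, comp_assoc.
    now apply is_zero_compr. }
  destruct (unit_factor adj t hI) as (s & hs).
  (* Checked after precomposition with the epimorphism [eta E], where both sides become [t ∘ p]. *)
  assert (hse : s ∘ fmap L p = e).
  { apply (regular_epi_epi (heta E)).
    transitivity (t ∘ p); [| exact ht].
    now rewrite <- hs, <- !comp_assoc, <- eta_natural. }
  exists (m ∘ s). split.
  - now rewrite <- comp_assoc, hse.
  - intros u hu. apply (reflector_epi heta (cokernel_epi hc)).
    rewrite <- comp_assoc. unfold L in *. now rewrite hse, hu.
Qed.

Lemma birkhoff_normal_mono (K E : C) (k : Hom K E) :
  is_normal_mono k -> is_mono (fmap L k) -> is_normal_mono (fmap L k).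
Proof.
  intros hk hm. destruct hX as (_ & heta & _).
  destruct hC as (_ & _ & _ & hn & himg).
  apply (himg _ _ _ _ k (eta K) (eta E) (fmap L k)).
  - symmetry. apply eta_natural.
  - exact hk.
  - apply hn, heta.
  - apply hn, heta.
  - exact hm.
Qed.

End Birkhoff.

Theorem theorem5p1 (C : Category) (hC : ideal_determined C)
  (X : C -> Prop) (F : Functor C (full_subcategory X))
  (adj : Adjunction F (inclusion X)) (hX : birkhoff adj) :
  conditionally_flat (comp_functor (inclusion X) F).
Proof.
  intros K E Q k p [hext [hLk _]] A P g p1 p2 hpb k' hk1 hk2.
  pose proof (extension_pullback hC hext hpb hk1 hk2) as hext'.
  pose proof (birkhoff_cokernel hC hX (proj2 hext')) as hcok.
  split; [exact hext' |]. split; [| exact hcok].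
  apply normal_mono_kernel_of_cokernel; [| exact hcok].
  apply (birkhoff_normal_mono hC hX).
  - exists A, p2. apply hext'.
  - intros Y u v huv. apply (kernel_mono hLk).
    now rewrite <- hk1, fmap_comp, <- !comp_assoc, huv.
Qed.
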